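(* Let $\mathscr{C}$ be one of $\mathbf{DL}$, $\mathbf{BDL}$, $\mathbf{BA}$, let $V$ be a set of propositional variables, and let $L$ be either $L_{\mathrm{RL}}$ (with model constructor $T=T_{\mathrm{RL}}$) or $L_{\mathrm{ML}}$ (with model constructor $T=T_{\mathrm{ML}}$), all as described in the context. Let $\mathcal{L}$ be the free $L$-algebra over the free $\mathscr{C}$-object on $V$. (Soundness) If $a,b$ are formulas with $a\le b$ in $\mathcal{L}$, then $[\![a]\!]\subseteq[\![b]\!]$ for every $T$-coalgebra $\gamma:W\to TW$ and every valuation. (Strong completeness) Let $\Phi,\Psi$ be sets of formulas such that there are no finite $\Phi_0\subseteq\Phi$ and $\Psi_0\subseteq\Psi$ with $\bigwedge\Phi_0\le\bigvee\Psi_0$ in $\mathcal{L}$. Here $\bigwedge\emptyset=\top$ and $\bigvee\emptyset=\bot$ when $\mathscr{C}$ is $\mathbf{BDL}$ or $\mathbf{BA}$, and only nonempty $\Phi_0,\Psi_0$ are considered when $\mathscr{C}=\mathbf{DL}$. Then there exist a $T$-coalgebra $\gamma:W\to TW$, a valuation $v$, and a point $w\in W$ such that $w\in[\![a]\!]$ for all $a\in\Phi$ and $w\notin[\![b]\!]$ for all $b\in\Psi$.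
   Context: $\mathbf{DL}$ is the category of distributive lattices (not necessarily bounded), $\mathbf{BDL}$ the category of bounded distributive lattices, and $\mathbf{BA}$ the category of Boolean algebras. Formulas are terms built from the variables in $V$ using the lattice operations of $\mathscr{C}$ (that is, $\wedge,\vee$, together with $\top,\bot$ for $\mathbf{BDL}$, and together with $\top,\bot,\neg$ for $\mathbf{BA}$) and the operations of $L$ described below. Operations of $L_{\mathrm{RL}}$: a constant $I$ and binary operations $\otimes$, $\backslash$, $/$. An $L_{\mathrm{RL}}$-algebra is an object $A$ of $\mathscr{C}$ with these operations satisfying, for every finite $X\subseteq A$ and every $a\in A$, the following laws. The set $X$ is required to be nonempty if $\mathscr{C}=\mathbf{DL}$; otherwise $\bigvee\emptyset=\bot$ and $\bigwedge\emptyset=\top$. - $(\bigvee X)\otimes a=\bigvee_{x\in X}(x\otimes a)$ - $a\otimes\bigvee X=\bigvee_{x\in X}(a\otimes x)$ - $a\backslash\bigwedge X=\bigwedge_{x\in X}(a\backslash x)$ - $(\bigvee X)\backslash a=\bigwedge_{x\in X}(x\backslash a)$ - $(\bigwedge X)/a=\bigwedge_{x\in X}(x/a)$ - $a/\bigvee X=\bigwedge_{x\in X}(a/x)$ Operations of $L_{\mathrm{ML}}$: unary $\Diamond,\Box$. An $L_{\mathrm{ML}}$-algebra is an object of $\mathscr{C}$ with these operations satisfying $\Diamond\bigvee X=\bigvee_{x\in X}\Diamond x$ and $\Box\bigwedge X=\bigwedge_{x\in X}\Box x$ for finite $X$ (nonempty if $\mathscr{C}=\mathbf{DL}$). Semantics.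 When $\mathscr{C}$ is $\mathbf{DL}$ or $\mathbf{BDL}$, $W$ ranges over posets; when $\mathscr{C}=\mathbf{BA}$, $W$ ranges over discrete posets (sets). $W^{\mathrm{op}}$ denotes the opposite order, and products are ordered componentwise. A subset $U$ of a poset is convex if $x,z\in U$ and $x\le y\le z$ imply $y\in U$. $\mathsf{P}_c(W)$ is the set of convex subsets of $W$ with the Egli–Milner order: $U\le U'$ iff every $u\in U$ has some $u'\in U'$ with $u\le u'$, and every $u'\in U'$ has some $u\in U$ with $u\le u'$. $\mathbf{2}=\{0,1\}$ is ordered by $1\le 0$. Define - $T_{\mathrm{RL}}W=\mathbf{2}\times\mathsf{P}_c(W\times W)\times\mathsf{P}_c(W^{\mathrm{op}}\times W)\times\mathsf{P}_c(W\times W^{\mathrm{op}})$, - $T_{\mathrm{ML}}W=\mathsf{P}_c(W)\times\mathsf{P}_c(W)$, both with the product order. A $T$-coalgebra is a monotone map $\gamma=(\gamma_1,\dots):W\to TW$. A valuation $v$ assigns to each $p\in V$ an up-set of $W$. Interpretation $[\![\cdot]\!]\subseteq W$: - $[\![p]\!]=v(p)$; $\wedge,\vee,\top,\bot,\neg$ are interpreted as intersection, union, $W$, $\emptyset$, and complement. - $w\in[\![I]\!]$ iff $\gamma_1(w)=0$. - $w\in[\![a\otimes b]\!]$ iff there is $(x,y)\in\gamma_2(w)$ with $x\in[\![a]\!]$ and $y\in[\![b]\!]$. - $w\in[\![a\backslash c]\!]$ iff for all $(x,y)\in\gamma_3(w)$, $x\in[\![a]\!]$ implies $y\in[\![c]\!]$.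 - $w\in[\![c/b]\!]$ iff for all $(x,y)\in\gamma_4(w)$, $y\in[\![b]\!]$ implies $x\in[\![c]\!]$. - For $T_{\mathrm{ML}}$, with $\gamma=(\gamma_1,\gamma_2)$: $w\in[\![\Diamond a]\!]$ iff $\gamma_1(w)\cap[\![a]\!]\neq\emptyset$, and $w\in[\![\Box a]\!]$ iff $\gamma_2(w)\subseteq[\![a]\!]$. *)

(* Defs.v *)
From HB Require Import structures.
From mathcomp Require Import all_boot all_order.
From mathcomp Require Import boolp classical_sets functions cardinality.
Set Implicit Arguments.
Unset Strict Implicit.
Unset Printing Implicit Defensive.
Import Order.TTheory.
Local Open Scope classical_set_scope.

Variant base := DL | BDL | BA.
Variant language := RL | ML.

Definition has_bounds (C : base) : bool := if C is DL then false else true.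
Definition has_compl (C : base) : bool := if C is BA then true else false.

(* [LRes a c] is a\c and [RRes c b] is c/b. *)
Inductive form (C : base) (V : Type) : language -> Type :=
| Var L (p : V) : form C V L
| And L (a b : form C V L) : form C V L
| Or L (a b : form C V L) : form C V L
| Top L (h : has_bounds C) : form C V L
| Bot L (h : has_bounds C) : form C V L
| Neg L (h : has_compl C) (a : form C V L) : form C V L
| One : form C V RL
| Tensor (a b : form C V RL) : form C V RL
| LRes (a c : form C V RL) : form C V RL
| RRes (c b : form C V RL) : form C V RL
| Dia (a : form C V ML) : form C V ML
| Box (a : form C V ML) : form C V ML.

Definition obj (d : Order.disp_t) (C : base) : Type :=
  match C with
  | DL => distrLatticeType d
  | BDL => tbDistrLatticeType d
  | BA => ctbDistrLatticeType d
  end.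

Definition lattice_of d C : obj d C -> distrLatticeType d :=
  match C with
  | DL => fun A => A
  | BDL => fun A => A
  | BA => fun A => A
  end.
Coercion lattice_of : obj >-> Order.DistrLattice.type.

Definition top_of d C : forall A : obj d C, has_bounds C -> A :=
  match C with
  | DL => fun _ h => match notF h with end
  | BDL => fun _ _ => \top%O
  | BA => fun _ _ => \top%O
  end.

Definition bot_of d C : forall A : obj d C, has_bounds C -> A :=
  match C with
  | DL => fun _ h => match notF h with end
  | BDL => fun _ _ => \bot%O
  | BA => fun _ _ => \bot%O
  end.

Definition compl_of d C : forall A : obj d C, has_compl C -> A -> A :=
  match C with
  | DL => fun _ h => match notF h with end
  | BDL => fun _ h => match notF h with end
  | BA => fun A _ x => Order.compl x
  end.

Definition base_hom d d' C (A : obj d C) (B : obj d' C) (f : A -> B) : Prop :=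
  [/\ {morph f : x y / Order.meet x y},
      {morph f : x y / Order.join x y},
      forall h : has_bounds C, f (top_of A h) = top_of B h,
      forall h : has_bounds C, f (bot_of A h) = bot_of B h
    & forall (h : has_compl C) x, f (compl_of h x) = compl_of h (f x)].

Record RL_ops (A : Type) := RLOps {
  one_op : A;
  tensor_op : A -> A -> A;
  lres_op : A -> A -> A;
  rres_op : A -> A -> A }.

Record ML_ops (A : Type) := MLOps {
  dia_op : A -> A;
  box_op : A -> A }.

Definition ops (L : language) (A : Type) : Type :=
  match L with RL => RL_ops A | ML => ML_ops A end.

(* An object of DL need not have a least or greatest element, so there the
   empty join and the empty meet are excluded. *)
Definition finitary (C : base) (T : Type) (X : set T) : Prop :=
  finite_set X /\ (has_bounds C \/ X !=set0).

(* [supremums X u] says that u is the join of X, the least element if X is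
   empty; dually for [infimums]. *)
Definition joins_to_joins d C (A : obj d C) (f : A -> A) : Prop :=
  forall X u, finitary C X -> supremums X u -> supremums (f @` X) (f u).
Definition meets_to_meets d C (A : obj d C) (f : A -> A) : Prop :=
  forall X u, finitary C X -> infimums X u -> infimums (f @` X) (f u).
Definition joins_to_meets d C (A : obj d C) (f : A -> A) : Prop :=
  forall X u, finitary C X -> supremums X u -> infimums (f @` X) (f u).

Record RL_laws d C (A : obj d C) (o : RL_ops A) : Prop := {
  tensor_joinl : forall a, joins_to_joins (fun x => tensor_op o x a);
  tensor_joinr : forall a, joins_to_joins (fun x => tensor_op o a x);
  lres_meet : forall a, meets_to_meets (fun x => lres_op o a x);
  lres_join : forall a, joins_to_meets (fun x => lres_op o x a);
  rres_meet : forall a, meets_to_meets (fun x => rres_op o x a);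
  rres_join : forall a, joins_to_meets (fun x => rres_op o a x) }.

Record ML_laws d C (A : obj d C) (o : ML_ops A) : Prop := {
  dia_join : joins_to_joins (dia_op o);
  box_meet : meets_to_meets (box_op o) }.

Definition laws d C L (A : obj d C) : ops L A -> Prop :=
  match L with RL => @RL_laws d C A | ML => @ML_laws d C A end.

Record alg (d : Order.disp_t) (C : base) (L : language) := Alg {
  alg_obj :> obj d C;
  alg_ops : ops L alg_obj;
  alg_laws : laws alg_ops }.

Definition ops_hom (L : language) (A B : Type) (f : A -> B) :
    ops L A -> ops L B -> Prop :=
  match L with
  | RL => fun o o' =>
      [/\ f (one_op o) = one_op o',
          {morph f : x y / tensor_op o x y >-> tensor_op o' x y},
          {morph f : x y / lres_op o x y >-> lres_op o' x y}
        & {morph f : x y / rres_op o x y >-> rres_op o' x y}]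
  | ML => fun o o' =>
      {morph f : x / dia_op o x >-> dia_op o' x} /\
      {morph f : x / box_op o x >-> box_op o' x}
  end.

Definition alg_hom d d' C L (A : alg d C L) (B : alg d' C L) (f : A -> B) :=
  base_hom f /\ ops_hom f (alg_ops A) (alg_ops B).

Fixpoint eval d C V L (a : form C V L) : forall F : alg d C L, (V -> F) -> F :=
  match a in form _ _ L return forall F : alg d C L, (V -> F) -> F with
  | Var _ p => fun F e => e p
  | And _ a b => fun F e => Order.meet (eval a e) (eval b e)
  | Or _ a b => fun F e => Order.join (eval a e) (eval b e)
  | Top _ h => fun F _ => top_of F h
  | Bot _ h => fun F _ => bot_of F h
  | Neg _ h a => fun F e => compl_of h (eval a e)
  | One => fun F _ => one_op (alg_ops F)
  | Tensor a b => fun F e => tensor_op (alg_ops F) (eval a e) (eval b e)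
  | LRes a c => fun F e => lres_op (alg_ops F) (eval a e) (eval c e)
  | RRes c b => fun F e => rres_op (alg_ops F) (eval c e) (eval b e)
  | Dia a => fun F e => dia_op (alg_ops F) (eval a e)
  | Box a => fun F e => box_op (alg_ops F) (eval a e)
  end.

Definition free_obj d C (V : Type) (D : obj d C) (i : V -> D) : Prop :=
  forall d' (A : obj d' C) (f : V -> A),
  exists h : D -> A,
    [/\ base_hom h, h \o i =1 f
      & forall k : D -> A, base_hom k -> k \o i =1 f -> k =1 h].

Definition free_alg d d' C L (D : obj d C) (F : alg d' C L) (j : D -> F) :
    Prop :=
  base_hom j /\
  forall d'' (A : alg d'' C L) (f : D -> A), base_hom f ->
  exists h : F -> A,
    [/\ alg_hom h, h \o j =1 f
      & forall k : F -> A, alg_hom k -> k \o j =1 f -> k =1 h].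

Definition convex d (T : porderType d) (U : set T) : Prop :=
  forall x y z, U x -> U z -> (x <= y)%O -> (y <= z)%O -> U y.

Definition Pc d (T : porderType d) : Type := {U : set T | convex U}.

Definition EM d (T : porderType d) (U U' : Pc T) : Prop :=
  (forall u, sval U u -> exists2 u', sval U' u' & (u <= u')%O) /\
  (forall u', sval U' u' -> exists2 u, sval U u & (u <= u')%O).

HB.instance Definition _ d (T : porderType d) := gen_eqMixin (Pc T).
HB.instance Definition _ d (T : porderType d) := gen_choiceMixin (Pc T).

Lemma EM_refl d (T : porderType d) : reflexive (fun U U' : Pc T => `[< EM U U' >]).
Proof. by move=> U; apply/asboolP; split=> u Uu; exists u. Qed.

Lemma EM_sub d (T : porderType d) (U U' : Pc T) :
  EM U U' -> EM U' U -> sval U `<=` sval U'.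
Proof.
move=> [h1 _] [_ h4] u Uu.
have [z U'z uz] := h1 _ Uu; have [x U'x xu] := h4 _ Uu.
exact: (svalP U') _ _ _ U'x U'z xu uz.
Qed.

Lemma EM_anti d (T : porderType d) :
  antisymmetric (fun U U' : Pc T => `[< EM U U' >]).
Proof.
move=> U U' /andP[/asboolP h /asboolP h'].
have: sval U = sval U' by apply/seteqP; split; exact: EM_sub.
by move: U U' {h h'} => [U cU] [U' cU'] /=; exact: eq_exist.
Qed.

Lemma EM_trans d (T : porderType d) :
  transitive (fun U U' : Pc T => `[< EM U U' >]).
Proof.
move=> U' U U'' /asboolP[h1 h2] /asboolP[h3 h4]; apply/asboolP; split=> u.
  by move=> /h1[u' /h3[u'' ? le2] le1]; exists u'' => //; exact: le_trans le2.
by move=> /h4[u' /h2[u'' ? le2] le1]; exists u'' => //; exact: le_trans le1.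
Qed.

Fact Pc_display : Order.disp_t. Proof. exact: Order.Disp tt tt. Qed.

HB.instance Definition _ d (T : porderType d) :=
  Order.Le_isPOrder.Build Pc_display (Pc T)
    (@EM_refl d T) (@EM_anti d T) (@EM_trans d T).

Fact T_display : Order.disp_t. Proof. exact: Order.Disp tt tt. Qed.

(* [bool^d] is {0, 1} with 1 <= 0, where 0 is [false] and 1 is [true]. *)
Definition T_RL d (W : porderType d) : porderType T_display :=
  bool^d *prod[T_display] Pc (W *p W) *prod[T_display] Pc (W^d *p W)
         *prod[T_display] Pc (W *p W^d).

Definition T_ML d (W : porderType d) : porderType T_display :=
  Pc W *prod[T_display] Pc W.

Definition T (L : language) d (W : porderType d) : porderType T_display :=
  match L with RL => T_RL W | ML => T_ML W end.

Definition RL_one d (W : porderType d) (t : T_RL W) : bool := t.1.1.1.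
Definition RL_tensor d (W : porderType d) (t : T_RL W) : set (W * W) :=
  sval t.1.1.2.
Definition RL_lres d (W : porderType d) (t : T_RL W) : set (W * W) :=
  sval t.1.2.
Definition RL_rres d (W : porderType d) (t : T_RL W) : set (W * W) := sval t.2.
Definition ML_dia d (W : porderType d) (t : T_ML W) : set W := sval t.1.
Definition ML_box d (W : porderType d) (t : T_ML W) : set W := sval t.2.

Definition coalgebra (L : language) d (W : porderType d) : Type :=
  {omorphism W -> T L W}.

Definition model_poset (C : base) d (W : porderType d) : Prop :=
  C = BA -> forall x y : W, (x <= y)%O -> x = y.

Definition upset d (W : porderType d) (U : set W) : Prop :=
  forall x y, U x -> (x <= y)%O -> U y.

Fixpoint sem C V L d (W : porderType d) (v : V -> set W) (a : form C V L) :
    (W -> T L W) -> set W :=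
  match a in form _ _ L return (W -> T L W) -> set W with
  | Var _ p => fun _ => v p
  | And _ a b => fun g => sem v a g `&` sem v b g
  | Or _ a b => fun g => sem v a g `|` sem v b g
  | Top _ _ => fun _ => setT
  | Bot _ _ => fun _ => set0
  | Neg _ _ a => fun g => ~` sem v a g
  | One => fun g => [set w | RL_one (g w) = false]
  | Tensor a b => fun g =>
      [set w | exists x y, [/\ RL_tensor (g w) (x, y), sem v a g x
                             & sem v b g y]]
  | LRes a c => fun g =>
      [set w | forall x y, RL_lres (g w) (x, y) -> sem v a g x -> sem v c g y]
  | RRes c b => fun g =>
      [set w | forall x y, RL_rres (g w) (x, y) -> sem v b g y -> sem v c g x]
  | Dia a => fun g => [set w | ML_dia (g w) `&` sem v a g !=set0]
  | Box a => fun g => [set w | ML_box (g w) `<=` sem v a g]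
  end.

(* Main.v *)
From HB Require Import structures.
Require Import Defs.
From mathcomp Require Import all_boot all_order.
From mathcomp Require Import boolp classical_sets functions cardinality.
Set Implicit Arguments.
Unset Strict Implicit.
Unset Printing Implicit Defensive.
Import Order.TTheory.
Local Open Scope classical_set_scope.

(** Soundness: the up-sets of a coalgebra form an [L]-algebra whose operations
    are the clauses of the semantics (all subsets, when the order is discrete),
    so the two freeness properties extend a valuation to a homomorphism, which
    is monotone and sends a formula to its interpretation.

    Completeness: the filter generated by [Phi] and the ideal generated by [Psi]
    are disjoint, hence separated by a prime filter [w]. Prime filters are the
    points of the canonical model, with the largest relations compatible with
    the operations; successors witnessing the truth lemma come from the prime
    filter theorem, applied once for each argument of the operation. *)

(** * Finite joins and meets *)

Lemma supremums_set2 d (A : latticeType d) (x y u : A) :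
  supremums [set x; y] u <-> u = Order.join x y.
Proof.
split=> [[ubu lbu]|->].
  apply/le_anti/andP; split; first by apply: lbu => z [] ->; rewrite ?leUl ?leUr.
  by rewrite leUx !ubu //; [right|left].
split; first by move=> z [] ->; rewrite ?leUl ?leUr.
by move=> z ubz; rewrite leUx !ubz //; [right|left].
Qed.

Lemma infimums_set2 d (A : latticeType d) (x y u : A) :
  infimums [set x; y] u <-> u = Order.meet x y.
Proof.
split=> [[lbu ubu]|->].
  apply/le_anti/andP; split; first by rewrite lexI !lbu //; [right|left].
  by apply: ubu => z [] ->; rewrite ?leIl ?leIr.
split; first by move=> z [] ->; rewrite ?leIl ?leIr.
by move=> z lbz; rewrite lexI !lbz //; [right|left].
Qed.

Lemma finitary_set1 C (T : Type) (x : T) : finitary C [set x].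
Proof. by split; [exact: finite_set1|right; exists x]. Qed.

Lemma finitary_set2 C (A : Type) (x y : A) : finitary C [set x; y].
Proof. by split; [exact: finite_set2|right; exists x; left]. Qed.

Lemma image_set2 (A B : Type) (f : A -> B) x y :
  f @` [set x; y] = [set f x; f y].
Proof. by rewrite image_setU !image_set1. Qed.

Lemma finitary_set0 C (A : Type) : has_bounds C -> finitary C (@set0 A).
Proof. by move=> h; split; [exact: finite_set0|left]. Qed.

Lemma le_top_of d C (A : obj d C) h (x : A) : (x <= top_of A h)%O.
Proof. by case: C A h x => //= A h x; exact: lex1. Qed.

Lemma bot_of_le d C (A : obj d C) h (x : A) : (bot_of A h <= x)%O.
Proof. by case: C A h x => //= A h x; exact: le0x. Qed.

Lemma supremums_set0 d C (A : obj d C) h : supremums set0 (bot_of A h).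
Proof. by split=> // x _; exact: bot_of_le. Qed.

Lemma infimums_set0 d C (A : obj d C) h : infimums set0 (top_of A h).
Proof. by split=> // x _; exact: le_top_of. Qed.

Lemma supremums_set0_eq d C (A : obj d C) h x :
  supremums set0 x -> x = bot_of A h.
Proof. by move=> [_ lb]; apply/le_anti; rewrite bot_of_le lb. Qed.

Lemma infimums_set0_eq d C (A : obj d C) h x :
  infimums set0 x -> x = top_of A h.
Proof. by move=> [_ ub]; apply/le_anti; rewrite le_top_of ub. Qed.

(** Two-element sets turn the set-wise laws into binary equations, and below the empty set yields
    their versions for the bounds. Completeness uses the laws in these forms. *)
Lemma joins_to_joinsU d C (A : obj d C) (f : A -> A) : joins_to_joins f ->
  {morph f : x y / Order.join x y}.
Proof.
move=> fJ x y; apply/supremums_set2; rewrite -image_set2.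
by apply: fJ; [exact: finitary_set2|exact/supremums_set2].
Qed.

Lemma meets_to_meetsI d C (A : obj d C) (f : A -> A) : meets_to_meets f ->
  {morph f : x y / Order.meet x y}.
Proof.
move=> fM x y; apply/infimums_set2; rewrite -image_set2.
by apply: fM; [exact: finitary_set2|exact/infimums_set2].
Qed.

Lemma joins_to_meetsU d C (A : obj d C) (f : A -> A) : joins_to_meets f ->
  {morph f : x y / Order.join x y >-> Order.meet x y}.
Proof.
move=> fM x y; apply/infimums_set2; rewrite -image_set2.
by apply: fM; [exact: finitary_set2|exact/supremums_set2].
Qed.

Lemma joins_to_joins0 d C (A : obj d C) (f : A -> A) h :
  joins_to_joins f -> f (bot_of A h) = bot_of A h.
Proof.
move=> fJ; apply: supremums_set0_eq; rewrite -(image_set0 f).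
by apply: fJ; [exact: finitary_set0|exact: supremums_set0].
Qed.

Lemma meets_to_meets1 d C (A : obj d C) (f : A -> A) h :
  meets_to_meets f -> f (top_of A h) = top_of A h.
Proof.
move=> fM; apply: infimums_set0_eq; rewrite -(image_set0 f).
by apply: fM; [exact: finitary_set0|exact: infimums_set0].
Qed.

Lemma joins_to_meets0 d C (A : obj d C) (f : A -> A) h :
  joins_to_meets f -> f (bot_of A h) = top_of A h.
Proof.
move=> fM; apply: infimums_set0_eq; rewrite -(image_set0 f).
by apply: fM; [exact: finitary_set0|exact: supremums_set0].
Qed.

Lemma joins_to_joins_le d C (A : obj d C) (f : A -> A) : joins_to_joins f ->
  {homo f : x y / (x <= y)%O}.
Proof.
by move=> fJ x y /join_r <-; rewrite (joins_to_joinsU fJ) leUl.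
Qed.

Lemma meets_to_meets_le d C (A : obj d C) (f : A -> A) : meets_to_meets f ->
  {homo f : x y / (x <= y)%O}.
Proof.
by move=> fM x y /meet_l <-; rewrite (meets_to_meetsI fM) leIr.
Qed.

Lemma joins_to_meets_le d C (A : obj d C) (f : A -> A) : joins_to_meets f ->
  {homo f : x y / (x <= y)%O >-> (y <= x)%O}.
Proof.
by move=> fM x y /join_r <-; rewrite (joins_to_meetsU fM) leIl.
Qed.

(** * Prime filters *)

(** In [DL] the empty set is a filter, and likewise an ideal; it is what an empty [Phi] or [Psi]
    generates there. *)
Record filter_set d C (A : obj d C) (G : set A) : Prop := FilterSet {
  filter_le : forall x y, (x <= y)%O -> G x -> G y;
  filter_meet : forall x y, G x -> G y -> G (Order.meet x y);
  filter_top : forall h, G (top_of A h) }.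

Record ideal_set d C (A : obj d C) (I : set A) : Prop := IdealSet {
  ideal_le : forall x y, (x <= y)%O -> I y -> I x;
  ideal_join : forall x y, I x -> I y -> I (Order.join x y);
  ideal_bot : forall h, I (bot_of A h) }.

(* For [DL] the empty and the full set count as prime filters. *)
Record prime_filter d C (A : obj d C) (P : set A) : Prop := PrimeFilter {
  prime_filter_set : filter_set P;
  prime_join : forall x y, P (Order.join x y) -> P x \/ P y;
  prime_bot : forall h, ~ P (bot_of A h) }.

(** This is the filter generated by [G] and [a]. An element of [G] is what brings the top, and [a]
    itself, into it. *)
Lemma filter_setU d C (A : obj d C) (G : set A) (a : A) : filter_set G ->
  G !=set0 -> filter_set [set z | exists2 p, G p & (Order.meet p a <= z)%O].
Proof.
move=> [Gle GI G1] [g Gg]; split=> [x y xy [p Gp px]|x y [p Gp px] [q Gq qy]|h].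
- by exists p => //; exact: le_trans xy.
- exists (Order.meet p q); first exact: GI.
  rewrite lexI (le_trans _ px) ?(le_trans _ qy) //.
    by rewrite leI2 // leIr.
  by rewrite leI2 // leIl.
- by exists g => //; exact: le_top_of.
Qed.

(** Zorn's lemma is applied to the sets [X] for which the union of [G] and [X] is a filter avoiding
    [I]. Adding [G] takes care of the empty chain, whose union then stands for [G] itself. *)
Lemma maximal_filter d C (A : obj d C) (G I : set A) : filter_set G ->
  (forall x, G x -> ~ I x) ->
  exists P : set A, [/\ filter_set P, G `<=` P, forall x, P x -> ~ I x
    & forall Q : set A, filter_set Q -> P `<=` Q -> (forall x, Q x -> ~ I x) ->
        Q `<=` P].
Proof.
move=> fG GI.
pose ok (X : set A) := filter_set (G `|` X) /\ forall x, (G `|` X) x -> ~ I x.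
have [|X [[fX XI] maxX]] := @Zorn_bigcup _ ok.
  move=> K Kok totK; split; last first.
    move=> x [/GI //|[X KX Xx]].
    by have [_ ] := Kok _ KX; apply; right.
  split=> [x y xy|x y|h]; last by left; exact: filter_top.
    move=> [Gx|[X KX Xx]]; first by left; exact: (filter_le fG) xy Gx.
    have [/filter_le/(_ _ _ xy) fX _] := Kok _ KX.
    by have [|?|?] := fX; [right|left|right; exists X].
  (* Two elements taken from different members of the chain both lie in the larger one, so it
     suffices to form meets inside a single member. *)
  have step X : K X -> (G `|` X) x -> (G `|` X) y ->
      (G `|` \bigcup_(X in K) X) (Order.meet x y).
    move=> KX Xx Xy; have [fX _] := Kok _ KX.
    by have [?|?] := filter_meet fX Xx Xy; [left|right; exists X].
  move=> [Gx|[X KX Xx]] [Gy|[Y KY Yy]].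
  - by left; exact: filter_meet.
  - by apply: (step Y) => //; [left|right].
  - by apply: (step X) => //; [right|left].
  - have [XY|YX] := totK _ _ KX KY.
      by apply: (step Y) => //; right => //; exact: XY.
    by apply: (step X) => //; right => //; exact: YX.
exists (G `|` X); split=> // Q fQ PQ QI.
have GQ : G `<=` Q by move=> x Gx; apply: PQ; left.
have okQ : ok Q by rewrite /ok (setUidr GQ).
apply: contrapT => QP; apply: (maxX Q) => //; split.
  by move=> x Xx; apply: PQ; right.
by move=> QX; apply: QP => x /QX; right.
Qed.

(** A filter [P] maximal among those avoiding [I] is prime. If [x] and [y] are both outside [P],
    then [p] and [q] in [P] exist with the meets of [p], [x] and of [q], [y] in [I]. By
    distributivity, the meet of [p], [q] and the join of [x], [y] lies below the join of these two
    meets, hence in [I]. *)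
Lemma prime_filter_separation d C (A : obj d C) (G I : set A) :
  filter_set G -> ideal_set I -> (forall x, G x -> ~ I x) ->
  exists P : set A, [/\ prime_filter P, G `<=` P & forall x, P x -> ~ I x].
Proof.
move=> fG [Ile IU I0] GI.
have [P [fP GP PI maxP]] := maximal_filter fG GI.
exists P; split=> //; split=> // [x y Pxy|h /PI]; last by apply; exact: I0.
(* Otherwise the filter generated by [P] and [a] would still avoid [I], and maximality would put [a]
   into [P]. *)
have meets_I a : ~ P a -> exists2 p, P p & I (Order.meet p a).
  move=> nPa; apply: contrapT => noI; apply: nPa.
  have Pne : P !=set0 by exists (Order.join x y).
  apply: (maxP _ (filter_setU a fP Pne)).
  - by move=> p Pp; exists p => //; rewrite leIl.
  - move=> z [p Pp pz] Iz; apply: noI; exists p => //; exact: Ile pz Iz.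
  - by exists (Order.join x y) => //; exact: leIr.
apply: contrapT => /not_orP[/meets_I[p Pp Ipx] /meets_I[q Pq Iqy]].
apply: (PI (Order.meet (Order.meet p q) (Order.join x y))).
  by apply: filter_meet => //; exact: filter_meet.
apply: Ile (IU _ _ Ipx Iqy); rewrite meetUr leU2 // leI2 //.
  exact: leIl.
exact: leIr.
Qed.

(** * The canonical model *)

Definition point d C (A : obj d C) : Type := {P : set A | prime_filter P}.

HB.instance Definition _ d C (A : obj d C) := gen_eqMixin (point A).
HB.instance Definition _ d C (A : obj d C) := gen_choiceMixin (point A).

Lemma eq_op_anti (X : eqType) : antisymmetric (@eq_op X).
Proof. by move=> x y /andP[/eqP]. Qed.

(* Discrete order: for [BDL] no coalgebra on prime filters ordered by inclusion
   can satisfy the truth lemma, since by Egli-Milner monotonicity the successor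
   sets of w <= w' are both empty or both nonempty. *)
HB.instance Definition _ d C (A : obj d C) :=
  Order.Le_isPOrder.Build T_display (point A) (@eqxx (point A))
    (@eq_op_anti (point A)) (@eq_op_trans (point A)).

Definition discrete d (X : porderType d) : Prop :=
  forall x y : X, (x <= y)%O -> x = y.

Lemma discrete_point d C (A : obj d C) : discrete (point A).
Proof. by move=> x y /eqP. Qed.

Lemma discrete_dual d (X : porderType d) : discrete X -> discrete X^d.
Proof. by move=> dX x y /dX. Qed.

Lemma discrete_prod d d' (X : porderType d) (Y : porderType d') :
  discrete X -> discrete Y -> discrete (X *p Y).
Proof. by move=> dX dY [x y] [x' y'] /andP[/dX /= -> /dY /= ->]. Qed.

Lemma discrete_convex d (X : porderType d) (U : set X) :
  discrete X -> convex U.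
Proof. by move=> dX x y z Ux _ /dX <-. Qed.

Definition Pc_of d (X : porderType d) (dX : discrete X) (U : set X) : Pc X :=
  exist _ U (discrete_convex dX).

Lemma point_separation d C (A : obj d C) (G I : set A) :
  filter_set G -> ideal_set I -> (forall x, G x -> ~ I x) ->
  exists w : point A, G `<=` sval w /\ forall x, sval w x -> ~ I x.
Proof.
move=> fG iI GI; have [P [pP GP PI]] := prime_filter_separation fG iI GI.
by exists (exist _ P pP).
Qed.

Lemma point_le d C (A : obj d C) (w : point A) x y :
  (x <= y)%O -> sval w x -> sval w y.
Proof. by move: (prime_filter_set (svalP w)) => /filter_le; exact. Qed.

Lemma point_meet d C (A : obj d C) (w : point A) x y :
  sval w (Order.meet x y) <-> sval w x /\ sval w y.
Proof.
split=> [wxy|[]]; last by apply: filter_meet; case: (svalP w).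
by split; apply: point_le wxy; rewrite ?leIl ?leIr.
Qed.

Lemma point_join d C (A : obj d C) (w : point A) x y :
  sval w (Order.join x y) <-> sval w x \/ sval w y.
Proof.
split; first by case: (svalP w) => _ + _; exact.
by case=> wx; apply: point_le wx; rewrite ?leUl ?leUr.
Qed.

Lemma point_top d C (A : obj d C) (w : point A) h : sval w (top_of A h).
Proof. by case: (svalP w) => [[_ _ +] _ _]; exact. Qed.

Lemma point_bot d C (A : obj d C) (w : point A) h : ~ sval w (bot_of A h).
Proof. by case: (svalP w) => _ _; exact. Qed.

(** A prime filter contains the top, which is the join of [x] and its complement, but not the
    bottom, which is their meet. *)
Lemma point_compl d C (A : obj d C) (w : point A) h x :
  sval w (compl_of h x) <-> ~ sval w x.
Proof.
case: C A w h x => //= A w h x; split=> [wnx wx|nwx].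
  have: sval w (Order.meet x (Order.compl x)) by apply/point_meet.
  rewrite Order.CTBDistrLatticeTheory.meetxC; exact: (@point_bot _ BA).
have: sval w (Order.join x (Order.compl x)).
  rewrite Order.CTBDistrLatticeTheory.joinxC; exact: (@point_top _ BA).
by case/point_join.
Qed.

(** * Prime filters as successors: witnesses for the operations *)

Lemma filter_above d C (A : obj d C) (a : A) :
  filter_set [set x | (a <= x)%O].
Proof.
split=> [x y xy|x y|h] /=; last exact: le_top_of.
  by move/le_trans; apply.
by rewrite lexI => -> ->.
Qed.

Lemma ideal_below d C (A : obj d C) (a : A) : ideal_set [set x | (x <= a)%O].
Proof.
split=> [x y xy|x y|h] /=; last exact: bot_of_le.
  exact: le_trans.
by rewrite leUx => -> ->.
Qed.

(** Since [f] preserves finite joins and [w] is prime, the [b] with [f b] outside [w] form an ideal.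
    By monotonicity of [f] it contains nothing above [a], so a prime filter through [a] avoids
    it. *)
Lemma dia_witness d C (A : obj d C) (f : A -> A) (w : point A) a :
  joins_to_joins f -> sval w (f a) ->
  exists x : point A, sval x a /\ forall b, sval x b -> sval w (f b).
Proof.
move=> fJ wfa.
have [] := point_separation (filter_above a) (I := [set b | ~ sval w (f b)]).
- split=> [x y xy + wx|x y + + |h] /=.
  + by apply; apply: point_le wx; exact: joins_to_joins_le.
  + by rewrite joins_to_joinsU // => ? ? /point_join[].
  + rewrite joins_to_joins0 //; exact: point_bot.
- by move=> b /= ab; apply; apply: point_le wfa; exact: joins_to_joins_le.
move=> x [ax xI]; exists x; split; first exact: ax (lexx _).
by move=> b /xI/contrapT.
Qed.

(** Dually, the [b] with [f b] in [w] form a filter because [f] preserves finite meets, and by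
    monotonicity it contains nothing below [a]. *)
Lemma box_witness d C (A : obj d C) (f : A -> A) (w : point A) a :
  meets_to_meets f -> ~ sval w (f a) ->
  exists x : point A, ~ sval x a /\ forall b, sval w (f b) -> sval x b.
Proof.
move=> fM nwfa.
have [] := point_separation (G := [set b | sval w (f b)]) _ (ideal_below a).
- split=> [x y xy|x y|h] /=.
  + by apply: point_le; exact: meets_to_meets_le.
  + by rewrite meets_to_meetsI // => ? ?; apply/point_meet.
  + rewrite meets_to_meets1 //; exact: point_top.
- by move=> b /= wb ba; apply: nwfa; apply: point_le wb; exact: meets_to_meets_le.
by move=> x [Gx xI]; exists x; split=> // /xI; apply; exact: lexx.
Qed.

(** The arguments are treated one at a time. First [x] is a successor for the unary operation with
    second argument fixed at [b]; then [y] contains [b] and avoids every [b'] for which some [a'] in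
    [x] puts [f a' b'] outside [w]. *)
Lemma tensor_witness d C (A : obj d C) (f : A -> A -> A) (w : point A) a b :
  (forall c, joins_to_joins (f^~ c)) -> (forall c, joins_to_joins (f c)) ->
  sval w (f a b) ->
  exists x y : point A, [/\ sval x a, sval y b
    & forall a' b', sval x a' -> sval y b' -> sval w (f a' b')].
Proof.
move=> fl fr wfab.
have [x [xa xw]] := dia_witness (fl b) wfab.
have fle a1 a2 b1 b2 : (a1 <= a2)%O -> (b1 <= b2)%O -> (f a1 b1 <= f a2 b2)%O.
  move=> a12 b12; apply: (@le_trans _ _ (f a2 b1)).
    exact: (joins_to_joins_le (fl b1)).
  exact: (joins_to_joins_le (fr a2)).
have [] := point_separation (filter_above b)
  (I := [set b' | exists2 a', sval x a' & ~ sval w (f a' b')]).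
- split=> [b1 b2 b12 [a' xa' nw]|b1 b2 [a1 xa1 nw1] [a2 xa2 nw2]|h] /=.
  + by exists a' => // w1; apply: nw; apply: point_le w1; exact: fle.
  (* The meet stays in the filter [x], and by monotonicity it serves as the bad first argument for
     both [b1] and [b2]; primeness of [w] then handles their join. *)
  + exists (Order.meet a1 a2); first exact/point_meet.
    rewrite (joins_to_joinsU (fr _)) => /point_join[w1|w2].
      by apply: nw1; apply: point_le w1; apply: fle => //; exact: leIl.
    by apply: nw2; apply: point_le w2; apply: fle => //; exact: leIr.
  (* The element [a] is known to lie in [x], and [f a] sends the bottom to the bottom, which no
     prime filter contains. *)
  + exists a => //; rewrite (joins_to_joins0 h (fr a)); exact: point_bot.
- move=> b' /= bb' [a' xa']; apply; apply: point_le (xw _ xa'); exact: fle.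
move=> y [by_ yI]; exists x, y; split=> //; first exact: by_ (lexx _).
move=> a' b' xa' /yI nI; apply: contrapT => nw; apply: nI; by exists a'.
Qed.

(** Here [f] is antitone in its first argument and monotone in its second. The conclusion side comes
    first: [y] omits [c] and contains every [c'] with [f a c'] in [w]. Then [x] contains [a] and
    avoids every [a'] for which some [c'] outside [y] has [f a' c'] in [w]. *)
Lemma res_witness d C (A : obj d C) (f : A -> A -> A) (w : point A) a c :
  (forall c, joins_to_meets (f^~ c)) -> (forall c, meets_to_meets (f c)) ->
  ~ sval w (f a c) ->
  exists x y : point A, [/\ sval x a, ~ sval y c
    & forall a' c', sval w (f a' c') -> sval x a' -> sval y c'].
Proof.
move=> fl fr nwfac.
have [y [nyc yw]] := box_witness (fr a) nwfac.
have fle a1 a2 b1 b2 : (a2 <= a1)%O -> (b1 <= b2)%O -> (f a1 b1 <= f a2 b2)%O.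
  move=> a12 b12; apply: (@le_trans _ _ (f a2 b1)).
    exact: (joins_to_meets_le (fl b1)).
  exact: (meets_to_meets_le (fr a2)).
have [] := point_separation (filter_above a)
  (I := [set a' | exists2 c', ~ sval y c' & sval w (f a' c')]).
- split=> [a1 a2 a12 [c' nyc' wc]|a1 a2 [c1 ny1 w1] [c2 ny2 w2]|h] /=.
  + by exists c' => //; apply: point_le wc; exact: fle.
  (* Primeness of [y] keeps the join outside [y], and by monotonicity it serves both [a1] and
     [a2]. *)
  + exists (Order.join c1 c2); first by case/point_join.
    rewrite (joins_to_meetsU (fl _)); apply/point_meet; split.
      by apply: point_le w1; apply: fle => //; exact: leUl.
    by apply: point_le w2; apply: fle => //; exact: leUr.
  + exists c => //; rewrite (joins_to_meets0 h (fl c)); exact: point_top.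
- move=> a' /= aa' [c' nyc' wc]; apply: nyc'; apply: yw.
  by apply: point_le wc; exact: fle.
move=> x [ax xI]; exists x, y; split=> //; first exact: ax (lexx _).
move=> a' c' wc /xI nI; apply: contrapT => nyc'; apply: nI; by exists c'.
Qed.

(** * The canonical coalgebra and the truth lemma *)

Definition canonical_RL d C (F : alg d C RL) (w : point F) : T_RL (point F) :=
  let o : RL_ops F := alg_ops F in
  let dW := @discrete_point _ _ F in
  let dW' := discrete_dual dW in
  (`[< ~ sval w (one_op o) >],
   Pc_of (discrete_prod dW dW)
     [set xy | forall a b, sval xy.1 a -> sval xy.2 b ->
                 sval w (tensor_op o a b)],
   Pc_of (discrete_prod dW' dW)
     [set xy | forall a c, sval w (lres_op o a c) -> sval (xy.1 : point F) a ->
                 sval xy.2 c],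
   Pc_of (discrete_prod dW dW')
     [set xy | forall c b, sval w (rres_op o c b) -> sval (xy.2 : point F) b ->
                 sval xy.1 c]).

Definition canonical_ML d C (F : alg d C ML) (w : point F) : T_ML (point F) :=
  let o : ML_ops F := alg_ops F in
  let dW := @discrete_point _ _ F in
  (Pc_of dW [set x | forall a, sval x a -> sval w (dia_op o a)],
   Pc_of dW [set x | forall a, sval w (box_op o a) -> sval x a]).

Definition canonical d C L : forall F : alg d C L, point F -> T L (point F) :=
  match L with
  | RL => @canonical_RL d C
  | ML => @canonical_ML d C
  end.

(** Induction on the formula. For the operations with a relation, one direction is the definition of
    the canonical relation, and the other takes its successors from the witness lemmas. *)
Lemma truth_lemma d C V L (a : form C V L) (F : alg d C L) (e : V -> F)
    (w : point F) :
  sem (fun p => [set w : point F | sval w (e p)]) a (@canonical _ _ _ F) w <->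
  sval w (eval a e).
Proof.
elim: a F e w => [{}L p|{}L a iha b ihb|{}L a iha b ihb|{}L h|{}L h|{}L h a iha
    | |a iha b ihb|a iha c ihc|c ihc b ihb|a iha|a iha] F e w //=.
- by rewrite point_meet -iha -ihb.
- by rewrite point_join -iha -ihb.
- by split=> // _; exact: point_top.
- by split=> // /point_bot.
- by rewrite point_compl -iha.
(* The value [true] stands for 1 and records that the unit is outside [w], so the clause for [I]
   reads as a double negation. *)
- rewrite /RL_one /=; split; first by move/asboolPn/contrapT.
  by move=> wo; apply/asboolPn; apply.
- have [fl fr _ _ _ _] := alg_laws F; split.
    by move=> [x [y [R /iha xa /ihb yb]]]; exact: R.
  move=> /(tensor_witness fl fr)[x [y [xa yb R]]].
  by exists x, y; split; [exact: R|exact/iha|exact/ihb].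
- have [_ _ fr fl _ _] := alg_laws F; split; last first.
    by move=> wac x y R /iha xa; apply/ihc; exact: R wac xa.
  move=> H; apply: contrapT => /(res_witness fl fr)[x [y [xa nyc R]]].
  by apply: nyc; apply/ihc; apply: (H x y R); exact/iha.
- have [_ _ _ _ fr fl] := alg_laws F; split; last first.
    by move=> wcb x y R /ihb yb; apply/ihc; exact: R wcb yb.
  move=> H; apply: contrapT.
  (* With the arguments of [/] swapped the denominator comes first, as [res_witness] expects; its
     successors are then returned in the order [y], [x]. *)
  move=> /(res_witness (f := fun b c => rres_op _ c b) fl fr)[y [x [yb nxc R]]].
  by apply: nxc; apply/ihc; apply: (H x y); [move=> c' b'; exact: R|exact/ihb].
- have [fJ _] := alg_laws F; split; first by move=> [x [R /iha /R]].
  by move=> /(dia_witness fJ)[x [xa R]]; exists x; split; [exact: R|exact/iha].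
- have [_ fM] := alg_laws F; split; last first.
    by move=> wa x R; apply/iha; exact: R.
  move=> H; apply: contrapT => /(box_witness fM)[x [nxa R]].
  by apply: nxa; apply/iha; exact: H.
Qed.

Lemma canonical_homo d C L (F : alg d C L) :
  {homo canonical (F := F) : x y / (x <= y)%O}.
Proof. by move=> x y /discrete_point ->. Qed.

HB.instance Definition _ d C L (F : alg d C L) :=
  Order.isOrderMorphism.Build _ _ _ _ (canonical (F := F)) (@canonical_homo d C L F).

(** * Generated filters and ideals, and strong completeness *)

Lemma filter_generated d C (A : obj d C) (T : Type) (f : T -> A) (Phi : set T) :
  filter_set [set x | exists Phi0 m, [/\ Phi0 `<=` Phi /\ finitary C Phi0,
    infimums (f @` Phi0) m & (m <= x)%O]].
Proof.
split=> [x y xy [X [m [? ? mx]]]|x y|h] /=.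
- by exists X, m; split=> //; exact: le_trans xy.
- move=> [X [m [[XP [finX neX]] [lbm glbm] mx]]].
  move=> [Y [n [[YP [finY neY]] [lbn glbn] ny]]].
  (* The infimum over a union is the meet of the two infima, and the union is again finitary. *)
  exists (X `|` Y), (Order.meet m n); split; last exact: leI2.
    split; first by rewrite subUset.
    split; first by rewrite finite_setU.
    by case: neX => [|[z Xz]]; [left|right; exists z; left].
  split.
    move=> _ [z [Xz|Yz] <-].
      by apply: le_trans (leIl _ _) _; apply: lbm; exists z.
    by apply: le_trans (leIr _ _) _; apply: lbn; exists z.
  move=> z lbz; rewrite lexI glbm ?glbn // => _ [t ? <-]; apply: lbz; exists t => //.
    by right.
  by left.
- exists set0, (top_of A h); split=> //; first by split=> //; exact: finitary_set0.
  by rewrite image_set0; exact: infimums_set0.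
Qed.

Lemma ideal_generated d C (A : obj d C) (T : Type) (f : T -> A) (Psi : set T) :
  ideal_set [set x | exists Psi0 n, [/\ Psi0 `<=` Psi /\ finitary C Psi0,
    supremums (f @` Psi0) n & (x <= n)%O]].
Proof.
split=> [x y xy [X [m [? ? mx]]]|x y|h] /=.
- by exists X, m; split=> //; exact: le_trans mx.
- move=> [X [m [[XP [finX neX]] [ubm lubm] mx]]].
  move=> [Y [n [[YP [finY neY]] [ubn lubn] ny]]].
  exists (X `|` Y), (Order.join m n); split; last exact: leU2.
    split; first by rewrite subUset.
    split; first by rewrite finite_setU.
    by case: neX => [|[z Xz]]; [left|right; exists z; left].
  split.
    move=> _ [z [Xz|Yz] <-].
      by apply: le_trans _ (leUl _ _); apply: ubm; exists z.
    by apply: le_trans _ (leUr _ _); apply: ubn; exists z.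
  move=> z ubz; rewrite leUx lubm ?lubn // => _ [t ? <-]; apply: ubz; exists t => //.
    by right.
  by left.
- exists set0, (bot_of A h); split=> //; first by split=> //; exact: finitary_set0.
  by rewrite image_set0; exact: supremums_set0.
Qed.

(** An element common to the generated filter and the generated ideal would lie between a finite
    meet from [Phi] and a finite join from [Psi], against the hypothesis. The truth lemma reads the
    separating prime filter as the required point. *)
Lemma strong_completeness d C V L (F : alg d C L) (e : V -> F)
    (Phi Psi : set (form C V L)) :
  ~ (exists Phi0 Psi0 (m n : F),
       [/\ Phi0 `<=` Phi /\ finitary C Phi0, Psi0 `<=` Psi /\ finitary C Psi0,
           infimums [set eval a e | a in Phi0] m,
           supremums [set eval b e | b in Psi0] n & (m <= n)%O]) ->
  exists w : point F,
    let v p := [set w : point F | sval w (e p)] in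
    (forall a, Phi a -> sem v a (canonical (F := F)) w) /\
    (forall b, Psi b -> ~ sem v b (canonical (F := F)) w).
Proof.
move=> nPhiPsi.
have [] := point_separation
  (filter_generated (fun a => eval a e) Phi)
  (ideal_generated (fun b => eval b e) Psi).
  move=> x [Phi0 [m [? ? mx]]] [Psi0 [n [? ? xn]]].
  by apply: nPhiPsi; exists Phi0, Psi0, m, n; split=> //; exact: le_trans mx xn.
move=> w [GP PI]; exists w; split=> [a Pa|b Pb].
  apply/truth_lemma; apply: GP; exists [set a], (eval a e); split=> //.
    by split; [move=> _ ->|exact: finitary_set1].
  by rewrite image_set1; split=> [_ ->|z /(_ _ erefl)].
move=> /truth_lemma /PI; apply; exists [set b], (eval b e); split=> //.
  by split; [move=> _ ->|exact: finitary_set1].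
by rewrite image_set1; split=> [_ ->|z /(_ _ erefl)].
Qed.

(** * The complex algebra of a coalgebra *)

Definition up d (W : porderType d) : Type := {U : set W | upset U}.

HB.instance Definition _ d (W : porderType d) := gen_eqMixin (up W).
HB.instance Definition _ d (W : porderType d) := gen_choiceMixin (up W).

Definition up_le d (W : porderType d) : rel (up W) :=
  fun U U' => `[< sval U `<=` sval U' >].

Lemma up_inj d (W : porderType d) : injective (fun U : up W => sval U).
Proof. by move=> [U uU] [U' uU'] /= ?; exact: eq_exist. Qed.

Lemma up_refl d (W : porderType d) : reflexive (@up_le d W).
Proof. by move=> U; apply/asboolP. Qed.

Lemma up_anti d (W : porderType d) : antisymmetric (@up_le d W).
Proof.
by move=> U U' /andP[/asboolP ? /asboolP ?]; apply/up_inj/seteqP.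
Qed.

Lemma up_trans d (W : porderType d) : transitive (@up_le d W).
Proof.
move=> U U' U'' /asboolP UU /asboolP UU'; apply/asboolP.
exact: subset_trans UU UU'.
Qed.

HB.instance Definition _ d (W : porderType d) :=
  Order.Le_isPOrder.Build T_display (up W)
    (@up_refl d W) (@up_anti d W) (@up_trans d W).

Lemma upset_setI d (W : porderType d) (U U' : set W) :
  upset U -> upset U' -> upset (U `&` U').
Proof. by move=> uU uU' x y [? ?] xy; split; [exact: uU xy|exact: uU' xy]. Qed.

Lemma upset_setU d (W : porderType d) (U U' : set W) :
  upset U -> upset U' -> upset (U `|` U').
Proof. by move=> uU uU' x y [?|?] xy; [left; exact: uU xy|right; exact: uU' xy]. Qed.

Definition up_meet d (W : porderType d) (U U' : up W) : up W :=
  exist _ _ (upset_setI (svalP U) (svalP U')).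

Definition up_join d (W : porderType d) (U U' : up W) : up W :=
  exist _ _ (upset_setU (svalP U) (svalP U')).

Lemma up_meetP d (W : porderType d) (U U' U'' : up W) :
  (U <= up_meet U' U'' = (U <= U') && (U <= U''))%O.
Proof.
apply/asboolP/andP => [|[/asboolP ? /asboolP ?]]; last by rewrite subsetI.
by rewrite subsetI => -[? ?]; split; apply/asboolP.
Qed.

Lemma up_joinP d (W : porderType d) (U U' U'' : up W) :
  (up_join U U' <= U'' = (U <= U'') && (U' <= U''))%O.
Proof.
apply/asboolP/andP => [|[/asboolP ? /asboolP ?]]; last by rewrite subUset.
by rewrite subUset => -[? ?]; split; apply/asboolP.
Qed.

HB.instance Definition _ d (W : porderType d) :=
  Order.POrder_MeetJoin_isLattice.Build T_display (up W)
    (@up_meetP d W) (@up_joinP d W).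

Lemma up_meetUl d (W : porderType d) :
  left_distributive (@Order.meet _ (up W)) Order.join.
Proof. by move=> U U' U''; apply: up_inj; exact: setIUl. Qed.

HB.instance Definition _ d (W : porderType d) :=
  Order.Lattice_Meet_isDistrLattice.Build T_display (up W) (@up_meetUl d W).

Definition up_bot d (W : porderType d) : up W :=
  exist (fun U : set W => upset U) set0 (fun _ _ x _ => x).

Definition up_top d (W : porderType d) : up W :=
  exist (fun U : set W => upset U) setT (fun _ _ _ _ => I).

Lemma up_bot_le d (W : porderType d) (U : up W) : (up_bot W <= U)%O.
Proof. by apply/asboolP. Qed.

Lemma le_up_top d (W : porderType d) (U : up W) : (U <= up_top W)%O.
Proof. by apply/asboolP. Qed.

HB.instance Definition _ d (W : porderType d) :=
  Order.hasBottom.Build T_display (up W) (@up_bot_le d W).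
HB.instance Definition _ d (W : porderType d) :=
  Order.hasTop.Build T_display (up W) (@le_up_top d W).

(** A second name for the lattice of up-sets that carries the proof of discreteness, so that a
    complement can be attached to it: in a discrete order every subset is an up-set. *)
Definition discrete_up d (W : porderType d) of discrete W : Type := up W.

HB.instance Definition _ d (W : porderType d) (dW : discrete W) :=
  Order.TBDistrLattice.copy (discrete_up dW) (up W).

Lemma discrete_upset d (W : porderType d) (U : set W) :
  discrete W -> upset U.
Proof. by move=> dW x y Ux /dW <-. Qed.

Definition up_compl d (W : porderType d) (dW : discrete W)
    (U : discrete_up dW) : discrete_up dW :=
  exist _ (~` sval U) (discrete_upset dW).

Lemma up_joinxC d (W : porderType d) (dW : discrete W) (U : discrete_up dW) :
  Order.join U (up_compl U) = \top%O.
Proof. by apply: up_inj; exact: setUv. Qed.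

Lemma up_meetxC d (W : porderType d) (dW : discrete W) (U : discrete_up dW) :
  Order.meet U (up_compl U) = \bot%O.
Proof. by apply: up_inj; exact: setICr. Qed.

HB.instance Definition _ d (W : porderType d) (dW : discrete W) :=
  Order.TBDistrLattice_hasComplement.Build T_display (discrete_up dW)
    (@up_joinxC d W dW) (@up_meetxC d W dW).

(** * Up-sets as an object of each base category *)

Definition up_obj C d (W : porderType d) :
    model_poset C W -> obj T_display C :=
  match C return model_poset C W -> obj T_display C with
  | DL => fun _ => (up W : distrLatticeType T_display)
  | BDL => fun _ => (up W : tbDistrLatticeType T_display)
  | BA => fun mW => (discrete_up (mW erefl) : ctbDistrLatticeType T_display)
  end.

(** This map and [up_obj_mk] are identities in each case; they bridge carriers that agree only after
    [C] is known. *)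
Definition up_obj_val C d (W : porderType d) :
    forall mW : model_poset C W, up_obj mW -> up W :=
  match C with DL => fun _ U => U | BDL => fun _ U => U | BA => fun _ U => U end.

Definition up_obj_mk C d (W : porderType d) :
    forall mW : model_poset C W, up W -> up_obj mW :=
  match C with DL => fun _ U => U | BDL => fun _ U => U | BA => fun _ U => U end.

(** Later computations compare underlying sets, which confines the case distinction on [C] to the
    basic lemmas on [ext]. *)
Definition ext C d (W : porderType d) (mW : model_poset C W) (x : up_obj mW) :
  set W := sval (up_obj_val x).

Lemma ext_mk C d (W : porderType d) (mW : model_poset C W) (U : up W) :
  ext (up_obj_mk mW U) = sval U.
Proof. by case: C mW. Qed.

Lemma ext_upset C d (W : porderType d) (mW : model_poset C W) (x : up_obj mW) :
  upset (ext x).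
Proof. exact: svalP. Qed.
Arguments ext_upset {C d W mW} x.

Lemma ext_le C d (W : porderType d) (mW : model_poset C W) (x y : up_obj mW) :
  (x <= y)%O <-> ext x `<=` ext y.
Proof. by case: C mW x y => mW x y; split=> /asboolP. Qed.

Lemma ext_meet C d (W : porderType d) (mW : model_poset C W) (x y : up_obj mW) :
  ext (Order.meet x y) = ext x `&` ext y.
Proof. by case: C mW x y. Qed.

Lemma ext_join C d (W : porderType d) (mW : model_poset C W) (x y : up_obj mW) :
  ext (Order.join x y) = ext x `|` ext y.
Proof. by case: C mW x y. Qed.

Lemma ext_top C d (W : porderType d) (mW : model_poset C W) h :
  ext (top_of (up_obj mW) h) = setT.
Proof. by case: C mW h. Qed.

Lemma ext_bot C d (W : porderType d) (mW : model_poset C W) h :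
  ext (bot_of (up_obj mW) h) = set0.
Proof. by case: C mW h. Qed.

Lemma ext_compl C d (W : porderType d) (mW : model_poset C W) h
    (x : up_obj mW) :
  ext (compl_of h x) = ~` ext x.
Proof. by case: C mW h x. Qed.

(** * Suprema and infima of up-sets as unions and intersections *)

Lemma upset_bigcup d (W : porderType d) (I : Type) (P : set I)
    (f : I -> set W) :
  (forall i, P i -> upset (f i)) -> upset (\bigcup_(i in P) f i).
Proof. by move=> uf x y [i Pi fx] xy; exists i => //; exact: uf fx xy. Qed.

Lemma upset_bigcap d (W : porderType d) (I : Type) (P : set I)
    (f : I -> set W) :
  (forall i, P i -> upset (f i)) -> upset (\bigcap_(i in P) f i).
Proof. by move=> uf x y fx xy i Pi; exact: uf (fx _ Pi) xy. Qed.

(** The union is itself an up-set, hence an upper bound against which the leastness of [u] can be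
    tested. The lemma for infima tests against the intersection. *)
Lemma supremums_ext C d (W : porderType d) (mW : model_poset C W)
    (X : set (up_obj mW)) (u : up_obj mW) :
  supremums X u <-> ext u = \bigcup_(x in X) ext x.
Proof.
have uX : upset (\bigcup_(x in X) ext x).
  by apply: upset_bigcup => x _; exact: ext_upset.
split=> [[ubu lbu]|uE].
  apply/seteqP; split; last by apply: bigcup_sub => x /ubu /ext_le.
  have := lbu (up_obj_mk mW (exist _ _ uX)).
  rewrite ext_le ext_mk /=; apply=> x Xx.
  by apply/ext_le; rewrite ext_mk /=; exact: bigcup_sup.
split=> [x Xx|z ubz]; apply/ext_le; rewrite uE; first exact: bigcup_sup.
by apply: bigcup_sub => x /ubz /ext_le.
Qed.

Lemma infimums_ext C d (W : porderType d) (mW : model_poset C W)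
    (X : set (up_obj mW)) (u : up_obj mW) :
  infimums X u <-> ext u = \bigcap_(x in X) ext x.
Proof.
have uX : upset (\bigcap_(x in X) ext x).
  by apply: upset_bigcap => x _; exact: ext_upset.
split=> [[lbu ubu]|uE].
  apply/seteqP; split; first by apply: sub_bigcap => x /lbu /ext_le.
  have := ubu (up_obj_mk mW (exist _ _ uX)).
  rewrite ext_le ext_mk /=; apply=> x Xx.
  by apply/ext_le; rewrite ext_mk /=; exact: bigcap_inf.
split=> [x Xx|z lbz]; apply/ext_le; rewrite uE; first exact: bigcap_inf.
by apply: sub_bigcap => x /lbz /ext_le.
Qed.

(** This reduces a law for finite joins to an operation on plain subsets commuting with arbitrary
    unions. The next two lemmas serve the laws that produce meets. *)
Lemma joins_to_joins_ext C d (W : porderType d) (mW : model_poset C W)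
    (f : up_obj mW -> up_obj mW) (phi : set W -> set W) :
  (forall x, ext (f x) = phi (ext x)) ->
  (forall I (P : set I) (U : I -> set W),
     phi (\bigcup_(i in P) U i) = \bigcup_(i in P) phi (U i)) ->
  joins_to_joins f.
Proof.
move=> fE phiU X u _ /supremums_ext uE; apply/supremums_ext.
by rewrite fE uE phiU bigcup_image; apply: eq_bigcupr => x _; rewrite fE.
Qed.

Lemma meets_to_meets_ext C d (W : porderType d) (mW : model_poset C W)
    (f : up_obj mW -> up_obj mW) (phi : set W -> set W) :
  (forall x, ext (f x) = phi (ext x)) ->
  (forall I (P : set I) (U : I -> set W),
     phi (\bigcap_(i in P) U i) = \bigcap_(i in P) phi (U i)) ->
  meets_to_meets f.
Proof.
move=> fE phiU X u _ /infimums_ext uE; apply/infimums_ext.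
by rewrite fE uE phiU bigcap_image; apply: eq_bigcapr => x _; rewrite fE.
Qed.

Lemma joins_to_meets_ext C d (W : porderType d) (mW : model_poset C W)
    (f : up_obj mW -> up_obj mW) (phi : set W -> set W) :
  (forall x, ext (f x) = phi (ext x)) ->
  (forall I (P : set I) (U : I -> set W),
     phi (\bigcup_(i in P) U i) = \bigcap_(i in P) phi (U i)) ->
  joins_to_meets f.
Proof.
move=> fE phiU X u _ /supremums_ext uE; apply/infimums_ext.
by rewrite fE uE phiU bigcap_image; apply: eq_bigcapr => x _; rewrite fE.
Qed.

(** * Operations on subsets induced by a relation *)

Definition exists_in (W : Type) (R : W -> set (W * W)) (U U' : set W) : set W :=
  [set w | exists x y, [/\ R w (x, y), U x & U' y]].

Definition forall_in (W : Type) (R : W -> set (W * W)) (U U' : set W) : set W :=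
  [set w | forall x y, R w (x, y) -> U x -> U' y].

(** The arguments are ordered as in [c / b], so the premise is the second one. *)
Definition rforall_in (W : Type) (R : W -> set (W * W)) (U U' : set W) :
  set W := [set w | forall x y, R w (x, y) -> U' y -> U x].

Lemma exists_in_bigcupl W (R : W -> set (W * W)) U' I (P : set I) U :
  exists_in R (\bigcup_(i in P) U i) U' = \bigcup_(i in P) exists_in R (U i) U'.
Proof.
apply/seteqP; split=> w.
  by move=> [x [y [Rw [i Pi Ux] Uy]]]; exists i => //; exists x, y.
by move=> [i Pi [x [y [Rw Ux Uy]]]]; exists x, y; split=> //; exists i.
Qed.

Lemma exists_in_bigcupr W (R : W -> set (W * W)) U I (P : set I) U' :
  exists_in R U (\bigcup_(i in P) U' i) = \bigcup_(i in P) exists_in R U (U' i).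
Proof.
apply/seteqP; split=> w.
  by move=> [x [y [Rw Ux [i Pi Uy]]]]; exists i => //; exists x, y.
by move=> [i Pi [x [y [Rw Ux Uy]]]]; exists x, y; split=> //; exists i.
Qed.

Lemma forall_in_bigcupl W (R : W -> set (W * W)) U' I (P : set I) U :
  forall_in R (\bigcup_(i in P) U i) U' = \bigcap_(i in P) forall_in R (U i) U'.
Proof.
apply/seteqP; split=> w H.
  by move=> i Pi x y Rw Ux; apply: H Rw _; exists i.
by move=> x y Rw [i Pi Ux]; exact: H Rw Ux.
Qed.

Lemma forall_in_bigcapr W (R : W -> set (W * W)) U I (P : set I) U' :
  forall_in R U (\bigcap_(i in P) U' i) = \bigcap_(i in P) forall_in R U (U' i).
Proof.
apply/seteqP; split=> w H.
  by move=> i Pi x y Rw Ux; exact: H Rw Ux _ Pi.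
by move=> x y Rw Ux i Pi; exact: H Rw Ux.
Qed.

Lemma rforall_in_bigcapl W (R : W -> set (W * W)) U' I (P : set I) U :
  rforall_in R (\bigcap_(i in P) U i) U' =
  \bigcap_(i in P) rforall_in R (U i) U'.
Proof.
apply/seteqP; split=> w H.
  by move=> i Pi x y Rw Uy; exact: H Rw Uy _ Pi.
by move=> x y Rw Uy i Pi; exact: H Rw Uy.
Qed.

Lemma rforall_in_bigcupr W (R : W -> set (W * W)) U I (P : set I) U' :
  rforall_in R U (\bigcup_(i in P) U' i) =
  \bigcap_(i in P) rforall_in R U (U' i).
Proof.
apply/seteqP; split=> w H.
  by move=> i Pi x y Rw Uy; apply: H Rw _; exists i.
by move=> x y Rw [i Pi Uy]; exact: H Rw Uy.
Qed.

(** * Monotone coalgebras keep interpretations up-closed *)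

Lemma T_RL_le d (W : porderType d) (t t' : T_RL W) : (t <= t')%O ->
  [/\ RL_one t' -> RL_one t, Defs.EM t.1.1.2 t'.1.1.2, Defs.EM t.1.2 t'.1.2
    & Defs.EM t.2 t'.2].
Proof.
move=> /andP[/andP[/andP[t1 /asboolP ?] /asboolP ?] /asboolP ?]; split=> //.
(* The order 1 <= 0 on the first component makes the implication run from [t'] to [t]. *)
by move: t1; rewrite /RL_one; case: t.1.1.1 t'.1.1.1 => [] [].
Qed.

Lemma T_ML_le d (W : porderType d) (t t' : T_ML W) :
  (t <= t')%O -> Defs.EM t.1 t'.1 /\ Defs.EM t.2 t'.2.
Proof. by move=> /andP[/asboolP ? /asboolP ?]. Qed.

(** The first half of the Egli-Milner order moves a witnessing pair at [w] up to a pair at [w']. *)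
Lemma upset_exists_in d (W : porderType d) (g : W -> Pc (W *p W)) U U' :
  {homo g : x y / (x <= y)%O} -> upset U -> upset U' ->
  upset (exists_in (fun w => sval (g w)) U U').
Proof.
move=> homg uU uU' w w' [x [y [Rw Ux Uy]]] /homg/asboolP[+ _].
move=> /(_ _ Rw)[[x' y'] Rw' /andP[/= xx yy]].
by exists x', y'; split=> //; [exact: uU xx|exact: uU' yy].
Qed.

(** By the second half of the Egli-Milner order a pair at [w'] lies above a pair at [w]. As the
    first coordinate is ordered by the opposite of [W], the premise passes from the pair at [w'] to
    the pair at [w], and the conclusion passes back. *)
Lemma upset_forall_in d (W : porderType d) (g : W -> Pc (W^d *p W)) U U' :
  {homo g : x y / (x <= y)%O} -> upset U -> upset U' ->
  upset (forall_in (fun w => sval (g w)) U U').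
Proof.
move=> homg uU uU' w w' H /homg/asboolP[_ +] x' y' Rw' Ux'.
move=> /(_ _ Rw')[[x y] Rw /andP[/= xx yy]].
by apply: uU' yy; apply: H Rw _; exact: uU xx.
Qed.

Lemma upset_rforall_in d (W : porderType d) (g : W -> Pc (W *p W^d)) U U' :
  {homo g : x y / (x <= y)%O} -> upset U -> upset U' ->
  upset (rforall_in (fun w => sval (g w)) U U').
Proof.
move=> homg uU uU' w w' H /homg/asboolP[_ +] x' y' Rw' Uy'.
move=> /(_ _ Rw')[[x y] Rw /andP[/= xx yy]].
by apply: uU xx; apply: H Rw _; exact: uU' yy.
Qed.

Lemma upset_dia d (W : porderType d) (g : W -> Pc W) U :
  {homo g : x y / (x <= y)%O} -> upset U ->
  upset [set w | sval (g w) `&` U !=set0].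
Proof.
move=> homg uU w w' [x [Rw Ux]] /homg/asboolP[+ _].
by move=> /(_ _ Rw)[x' Rw' xx]; exists x'; split=> //; exact: uU xx.
Qed.

Lemma upset_box d (W : porderType d) (g : W -> Pc W) U :
  {homo g : x y / (x <= y)%O} -> upset U -> upset [set w | sval (g w) `<=` U].
Proof.
move=> homg uU w w' H /homg/asboolP[_ +] x' Rw'.
by move=> /(_ _ Rw')[x Rw xx]; apply: uU xx; exact: H.
Qed.

Lemma T_RL_homo d (W : porderType d) (g : coalgebra RL W) :
  [/\ upset [set w | RL_one (g w) = false],
      {homo (fun w => (g w : T_RL W).1.1.2) : x y / (x <= y)%O},
      {homo (fun w => (g w : T_RL W).1.2) : x y / (x <= y)%O}
    & {homo (fun w => (g w : T_RL W).2) : x y / (x <= y)%O}].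
Proof.
have homg x y : (x <= y)%O -> (g x <= g y)%O by exact: omorph_le.
split=> x y.
- by move=> /= gx /homg/T_RL_le[]; rewrite gx; case: RL_one => // ->.
- by move=> /homg/T_RL_le[_ ? _ _]; apply/asboolP.
- by move=> /homg/T_RL_le[_ _ ? _]; apply/asboolP.
- by move=> /homg/T_RL_le[_ _ _ ?]; apply/asboolP.
Qed.

Lemma T_ML_homo d (W : porderType d) (g : coalgebra ML W) :
  {homo (fun w => (g w : T_ML W).1) : x y / (x <= y)%O} /\
  {homo (fun w => (g w : T_ML W).2) : x y / (x <= y)%O}.
Proof.
have homg x y : (x <= y)%O -> (g x <= g y)%O by exact: omorph_le.
by split=> x y /homg/T_ML_le[? ?]; apply/asboolP.
Qed.

(** * The operations of the complex algebra and their laws *)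

Definition up_obj_of C d (W : porderType d) (mW : model_poset C W)
    (U : set W) (uU : upset U) : up_obj mW :=
  up_obj_mk mW (exist _ U uU).

Lemma ext_of C d (W : porderType d) (mW : model_poset C W)
    (U : set W) (uU : upset U) :
  ext (up_obj_of mW uU) = U.
Proof. exact: ext_mk. Qed.

Definition complex_RL C d (W : porderType d) (mW : model_poset C W)
    (g : coalgebra RL W) : RL_ops (up_obj mW) :=
  let: And4 u1 h2 h3 h4 := T_RL_homo g in
  {| one_op := up_obj_of mW u1;
     tensor_op x y :=
       up_obj_of mW (upset_exists_in h2 (ext_upset x) (ext_upset y));
     lres_op x y :=
       up_obj_of mW (upset_forall_in h3 (ext_upset x) (ext_upset y));
     rres_op x y :=
       up_obj_of mW (upset_rforall_in h4 (ext_upset x) (ext_upset y)) |}.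

Definition complex_ML C d (W : porderType d) (mW : model_poset C W)
    (g : coalgebra ML W) : ML_ops (up_obj mW) :=
  let: conj h1 h2 := T_ML_homo g in
  {| dia_op x := up_obj_of mW (upset_dia h1 (ext_upset x));
     box_op x := up_obj_of mW (upset_box h2 (ext_upset x)) |}.

(** The operations are defined by matching on the proof [T_RL_homo g], which has to be destructed
    before they compute; the same holds for the lemmas below, with [T_ML_homo] for [ML]. *)
Lemma ext_one C d (W : porderType d) (mW : model_poset C W)
    (g : coalgebra RL W) :
  ext (one_op (complex_RL mW g)) = [set w | RL_one (g w) = false].
Proof. by rewrite /complex_RL; case: T_RL_homo => ? ? ? ?; exact: ext_of. Qed.

Lemma ext_tensor C d (W : porderType d) (mW : model_poset C W)
    (g : coalgebra RL W) x y :
  ext (tensor_op (complex_RL mW g) x y) =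
  exists_in (fun w => RL_tensor (g w)) (ext x) (ext y).
Proof. by rewrite /complex_RL; case: T_RL_homo => ? ? ? ?; exact: ext_of. Qed.

Lemma ext_lres C d (W : porderType d) (mW : model_poset C W)
    (g : coalgebra RL W) x y :
  ext (lres_op (complex_RL mW g) x y) =
  forall_in (fun w => RL_lres (g w)) (ext x) (ext y).
Proof. by rewrite /complex_RL; case: T_RL_homo => ? ? ? ?; exact: ext_of. Qed.

Lemma ext_rres C d (W : porderType d) (mW : model_poset C W)
    (g : coalgebra RL W) x y :
  ext (rres_op (complex_RL mW g) x y) =
  rforall_in (fun w => RL_rres (g w)) (ext x) (ext y).
Proof. by rewrite /complex_RL; case: T_RL_homo => ? ? ? ?; exact: ext_of. Qed.

Lemma ext_dia C d (W : porderType d) (mW : model_poset C W)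
    (g : coalgebra ML W) x :
  ext (dia_op (complex_ML mW g) x) = [set w | ML_dia (g w) `&` ext x !=set0].
Proof. by rewrite /complex_ML; case: T_ML_homo => ? ?; exact: ext_of. Qed.

Lemma ext_box C d (W : porderType d) (mW : model_poset C W)
    (g : coalgebra ML W) x :
  ext (box_op (complex_ML mW g) x) = [set w | ML_box (g w) `<=` ext x].
Proof. by rewrite /complex_ML; case: T_ML_homo => ? ?; exact: ext_of. Qed.

Lemma complex_RL_laws C d (W : porderType d) (mW : model_poset C W)
    (g : coalgebra RL W) : RL_laws (complex_RL mW g).
Proof.
split=> a.
- apply: (joins_to_joins_ext (phi 
   := fun U => exists_in (fun w => RL_tensor (g w)) U (ext a))).
    by move=> x; exact: ext_tensor.
  by move=> I P U; exact: exists_in_bigcupl.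
- apply: (joins_to_joins_ext (phi := exists_in (fun w => RL_tensor (g w)) (ext a))).
    by move=> x; exact: ext_tensor.
  by move=> I P U; exact: exists_in_bigcupr.
- apply: (meets_to_meets_ext (phi := forall_in (fun w => RL_lres (g w)) (ext a))).
    by move=> x; exact: ext_lres.
  by move=> I P U; exact: forall_in_bigcapr.
- apply: (joins_to_meets_ext (phi := fun U => forall_in (fun w => RL_lres (g w)) U (ext a))).
    by move=> x; exact: ext_lres.
  by move=> I P U; exact: forall_in_bigcupl.
- apply: (meets_to_meets_ext (phi := fun U => rforall_in (fun w => RL_rres (g w)) U (ext a))).
    by move=> x; exact: ext_rres.
  by move=> I P U; exact: rforall_in_bigcapl.
- apply: (joins_to_meets_ext (phi := rforall_in (fun w => RL_rres (g w)) (ext a))).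
    by move=> x; exact: ext_rres.
  by move=> I P U; exact: rforall_in_bigcupr.
Qed.

Lemma complex_ML_laws C d (W : porderType d) (mW : model_poset C W)
    (g : coalgebra ML W) : ML_laws (complex_ML mW g).
Proof.
split.
- apply: (joins_to_joins_ext (phi := fun U => [set w | ML_dia (g w) `&` U !=set0])).
    by move=> x; exact: ext_dia.
  move=> I P U.
  apply/seteqP; split=> [w [x [Rw [i Pi Ux]]]|w [i Pi [x [Rw Ux]]]].
    by exists i => //; exists x.
  by exists x; split=> //; exists i.
- apply: (meets_to_meets_ext (phi := fun U => [set w | ML_box (g w) `<=` U])).
    by move=> x; exact: ext_box.
  move=> I P U.
  apply/seteqP; split=> w H; first by move=> i Pi x /H; exact.
  by move=> x Rw i Pi; exact: (H i Pi).
Qed.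

Definition complex_ops C L d (W : porderType d) (mW : model_poset C W) :
    coalgebra L W -> ops L (up_obj mW) :=
  match L with RL => @complex_RL C d W mW | ML => @complex_ML C d W mW end.

Lemma complex_laws C L d (W : porderType d) (mW : model_poset C W)
    (g : coalgebra L W) : laws (complex_ops mW g).
Proof. by case: L g; [exact: complex_RL_laws|exact: complex_ML_laws]. Qed.

Definition complex_alg C L d (W : porderType d) (mW : model_poset C W)
    (g : coalgebra L W) : alg T_display C L :=
  Alg (complex_laws mW g).

(** Induction on the formula: in each compound case [h] commutes with the operation, and [ext] turns
    the operation of the complex algebra into the semantic clause. *)
Lemma sem_eval C L V d (W : porderType d) (mW : model_poset C W)
    (a : form C V L) (g : coalgebra L W) d' (F : alg d' C L) (e : V -> F)
    (h : F -> complex_alg mW g) :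
  alg_hom h ->
  sem (fun p => ext (h (e p) : up_obj mW)) a g = ext (h (eval a e) : up_obj mW).
Proof.
elim: a g F e h => [{}L p|{}L a iha b ihb|{}L a iha b ihb|{}L c|{}L c
    |{}L c a iha||a iha b ihb|a iha c ihc|c ihc b ihb|a iha|a iha] g F e h
    hh /=; have [[hI hU h1 h0 hC] ho] := hh.
- by [].
- by rewrite (iha _ _ _ _ hh) (ihb _ _ _ _ hh) hI ext_meet.
- by rewrite (iha _ _ _ _ hh) (ihb _ _ _ _ hh) hU ext_join.
- by rewrite h1 ext_top.
- by rewrite h0 ext_bot.
- by rewrite (iha _ _ _ _ hh) hC ext_compl.
- by case: ho => -> _ _ _; rewrite ext_one.
- case: ho => _ -> _ _.
  by rewrite (iha _ _ _ _ hh) (ihb _ _ _ _ hh) ext_tensor.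
- case: ho => _ _ -> _.
  by rewrite (iha _ _ _ _ hh) (ihc _ _ _ _ hh) ext_lres.
- case: ho => _ _ _ ->.
  by rewrite (ihc _ _ _ _ hh) (ihb _ _ _ _ hh) ext_rres.
- by case: ho => -> _; rewrite (iha _ _ _ _ hh) ext_dia.
- by case: ho => _ ->; rewrite (iha _ _ _ _ hh) ext_box.
Qed.

(** * Soundness and strong completeness from freeness *)

Lemma base_hom_le d d' C (A : obj d C) (B : obj d' C) (f : A -> B) :
  base_hom f -> {homo f : x y / (x <= y)%O}.
Proof. by move=> [fI _ _ _ _] x y /meet_l <-; rewrite fI leIr. Qed.

Theorem theorem3 (C : base) (V : Type) (L : language)
  (dD : Order.disp_t) (D : obj dD C) (i : V -> D) (freeD : free_obj i)
  (dF : Order.disp_t) (F : alg dF C L) (j : D -> F) (freeF : free_alg j) :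
  (forall a b : form C V L, (eval a (j \o i) <= eval b (j \o i))%O ->
     forall (d : Order.disp_t) (W : porderType d) (g : coalgebra L W)
       (v : V -> set W),
       model_poset C W -> (forall p, upset (v p)) ->
       sem v a g `<=` sem v b g)
  /\
  (forall Phi Psi : set (form C V L),
     ~ (exists (Phi0 Psi0 : set (form C V L)) (m n : F),
          [/\ Phi0 `<=` Phi /\ finitary C Phi0,
              Psi0 `<=` Psi /\ finitary C Psi0,
              infimums [set eval a (j \o i) | a in Phi0] m,
              supremums [set eval b (j \o i) | b in Psi0] n
            & (m <= n)%O]) ->
     exists (d : Order.disp_t) (W : porderType d) (g : coalgebra L W)
       (v : V -> set W) (w : W),
       [/\ model_poset C W, forall p, upset (v p),
           forall a, Phi a -> sem v a g w
         & forall b, Psi b -> ~ sem v b g w]).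
Proof.
split=> [a b ab d W g v mW uv|Phi Psi /strong_completeness[w [wPhi wPsi]]].
  (* Freeness is used twice: the valuation extends from [V] to [D], and this extension to a
     homomorphism from [F] into the complex algebra. *)
  have [h0 [h0_hom h0E _]] := freeD _ _ (fun p => up_obj_of mW (uv p)).
  have [_ /(_ _ (complex_alg mW g) _ h0_hom)[h [h_hom hE _]]] := freeF.
  (* Written through [h], the valuation has the form required by [sem_eval]. *)
  have vE : v = fun p => ext (h ((j \o i) p) : up_obj mW).
    apply: funext => p; have /= -> := hE (i p); have /= -> := h0E p.
    by rewrite ext_of.
  rewrite vE !(sem_eval _ _ h_hom); apply/ext_le.
  exact: base_hom_le h_hom.1 _ _ ab.
exists _, (point F), (canonical (F := F) : {omorphism _ -> _}),
  (fun p => [set w : point F | sval w ((j \o i) p)]), w.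
split; [| |exact: wPhi|exact: wPsi].
  by move=> _; exact: discrete_point.
by move=> p; exact: discrete_upset (@discrete_point _ _ F).
Qed.
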